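(* Let $\mathcal{R} = \langle \Sigma, \mathcal{I}, \mathcal{T}\rangle$ be a regular transition system, and let $\langle \Gamma, \mathcal{V}\rangle$ be an interpretation with interpreter $\mathcal{V}$. Let $n_{\mathcal{I}}$, $n_{\mathcal{T}}$ and $n_{\mathcal{V}}$ be the numbers of states of $\mathcal{I}$, $\mathcal{T}$ and $\mathcal{V}$, respectively. Then the set of configurations $\mathit{IndInv}_{\mathcal{V}}$ is recognized by an NFA with at most $$n_{\mathcal{I}} \cdot 2^{2^{\log (n_{\mathcal{V}}^2)\, \cdot\, n_{\mathcal{T}}\, \cdot\, n_{\mathcal{V}}^2}}$$ states.
   Context: All alphabets are finite. An NFA has a nonempty finite set of states, possibly several initial states, and no $\varepsilon$-transitions. It is deterministic (a DFA) if it has exactly one initial state and exactly one successor for every state and letter (so it is complete). For words $w \in \Sigma^*$, $u \in \Gamma^*$ of the same length $\ell$, $\langle w,u\rangle$ denotes the word $\langle w[1],u[1]\rangle \cdots \langle w[\ell],u[\ell]\rangle \in (\Sigma\times\Gamma)^*$. A (length-preserving) transducer over $\Sigma\times\Gamma$ is an NFA over the alphabet $\Sigma \times \Gamma$; it recognizes the relation of all pairs $\langle w,u\rangle$ (necessarily $|w|=|u|$) that it accepts, and is deterministic if it is a DFA. $\log$ is the base-2 logarithm. A regular transition system (RTS) is a triple $\langle \Sigma, \mathcal{I}, \mathcal{T}\rangle$ with $\Sigma$ an alphabet, $\mathcal{I}$ an NFA over $\Sigma$, and $\mathcal{T}$ a (possibly nondeterministic) transducer over $\Sigma\times\Sigma$.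 Words over $\Sigma$ are configurations; those accepted by $\mathcal{I}$ are initial; $w \leadsto u$ means that $\langle w,u\rangle$ is accepted by $\mathcal{T}$. An interpretation is a pair $\langle\Gamma,\mathcal{V}\rangle$ with $\Gamma$ an alphabet and $\mathcal{V}$ (the interpreter) a deterministic transducer over $\Sigma\times\Gamma$. For $w\in\Sigma^*$, $W\in\Gamma^*$ write $w \models_{\mathcal{V}} W$ if $|w|=|W|$ and $\langle w,W\rangle$ is accepted by $\mathcal{V}$. Let $$\mathit{Ind}_{\mathcal{V}} = \{W\in\Gamma^* \mid \text{for all } u,w\in\Sigma^*: \text{ if } u\leadsto w \text{ and } u\models_{\mathcal{V}} W, \text{ then } w\models_{\mathcal{V}} W\}.$$ For $u,w\in\Sigma^*$ with $|u|=|w|$, write $u \stackrel{*}{\leadsto}_{\mathcal{V}} w$ if for every $W\in \mathit{Ind}_{\mathcal{V}}$, $u\models_{\mathcal{V}} W$ implies $w\models_{\mathcal{V}} W$ (all relations considered are length-preserving, so the relation only contains pairs of words of equal length). Finally, $\mathit{IndInv}_{\mathcal{V}} = \{w\in\Sigma^* \mid u \stackrel{*}{\leadsto}_{\mathcal{V}} w \text{ for some initial configuration } u\}$. *)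

(* Defs.v *)
From mathcomp Require Import all_boot all_order all_algebra.
From mathcomp Require Import reals exp.

Set Implicit Arguments.
Unset Strict Implicit.
Unset Printing Implicit Defensive.

Record nfa (A : finType) : Type := NFA {
  nfa_state : finType;
  nfa_nonempty : 0 < #|nfa_state|;
  nfa_init : {set nfa_state};
  nfa_trans : nfa_state -> A -> {set nfa_state};
  nfa_final : {set nfa_state}
}.

Definition nfa_size (A : finType) (N : nfa A) : nat := #|nfa_state N|.

Definition deterministic (A : finType) (N : nfa A) : Prop :=
  #|nfa_init N| = 1 /\ forall q a, #|nfa_trans (n := N) q a| = 1.

Fixpoint accepts_from (A : finType) (N : nfa A) (q : nfa_state N)
    (w : seq A) : Prop :=
  if w is a :: w' then
    exists2 q', q' \in nfa_trans q a & accepts_from q' w'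
  else q \in nfa_final N.

Definition accepts (A : finType) (N : nfa A) (w : seq A) : Prop :=
  exists2 q, q \in nfa_init N & accepts_from q w.

Definition recognizes (A : finType) (N : nfa A) (L : seq A -> Prop) : Prop :=
  forall w, accepts N w <-> L w.

Notation transducer A B := (nfa (A * B)%type).

(* [zip] truncates the longer word, hence the explicit length condition. *)
Definition accepts_pair (A B : finType) (T : transducer A B)
    (w : seq A) (u : seq B) : Prop :=
  size w = size u /\ accepts T (zip w u).

Record rts (Sigma : finType) : Type := RTS {
  rts_init : nfa Sigma;
  rts_trans : transducer Sigma Sigma
}.

Record interpretation (Sigma : finType) : Type := Interpretation {
  int_alphabet : finType;
  interpreter : transducer Sigma int_alphabet;
  interpreter_det : deterministic interpreter
}.

Section InductiveInvariants.
Variables (Sigma : finType) (S : rts Sigma) (V : interpretation Sigma).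

Definition initial (w : seq Sigma) : Prop := accepts (rts_init S) w.

Definition step (w u : seq Sigma) : Prop := accepts_pair (rts_trans S) w u.

Definition models (w : seq Sigma) (W : seq (int_alphabet V)) : Prop :=
  accepts_pair (interpreter V) w W.

Definition Ind (W : seq (int_alphabet V)) : Prop :=
  forall u w : seq Sigma, step u w -> models u W -> models w W.

Definition potreach (u w : seq Sigma) : Prop :=
  size u = size w /\
  forall W : seq (int_alphabet V), Ind W -> models u W -> models w W.

Definition IndInv (w : seq Sigma) : Prop :=
  exists2 u, initial u & potreach u w.

End InductiveInvariants.

Definition log2 (R : realType) (x : R) : R := (ln x / ln 2)%R.

(* Main.v *)
(** [IndInv] is built from the given automata by intersections, inverse and
    direct letter-to-letter images, and two complementations.  [Ind] is the
    complement of an NFA with [nT * nV ^ 2] states guessing a violating step,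
    hence has at most [2 ^ (nT * nV ^ 2)] states; the pairs separated by some
    inductive [W] form an NFA with [m * 2 ^ (nT * m)] states, [m = nV ^ 2]; its
    complement is intersected with [I] and projected.  If [nV > 1] then
    [m >= 4], so that [m * 2 ^ (nT * m) <= m ^ (nT * m)], which is the claimed
    exponent.  If [nV = 1] this estimate fails, but then the interpreter cannot
    distinguish configurations of equal length, and [nI] states suffice. *)

Require Import Defs.
From mathcomp Require Import all_boot all_order all_algebra.
From mathcomp Require Import reals exp.

Set Implicit Arguments.
Unset Strict Implicit.
Unset Printing Implicit Defensive.

Lemma card_powersetT (T : finType) : #|{set T}| = 2 ^ #|T|.
Proof. by rewrite -[#|T|]cardsT -card_powerset powersetT cardsT. Qed.

(** * Closure of NFA languages under intersection, letter maps and complement *)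

Section Closure.
Variables A B : finType.

Lemma nfa_inter_nonempty (M N : nfa A) :
  0 < #|{: nfa_state M * nfa_state N}|.
Proof. by rewrite card_prod muln_gt0 !nfa_nonempty. Qed.

Definition nfa_inter (M N : nfa A) : nfa A :=
  @NFA A _ (nfa_inter_nonempty M N)
    (setX (nfa_init M) (nfa_init N))
    (fun q a => setX (nfa_trans q.1 a) (nfa_trans q.2 a))
    (setX (nfa_final M) (nfa_final N)).

Lemma nfa_size_inter (M N : nfa A) :
  nfa_size (nfa_inter M N) = nfa_size M * nfa_size N.
Proof. exact: card_prod. Qed.

Lemma accepts_inter (M N : nfa A) w :
  accepts (nfa_inter M N) w <-> accepts M w /\ accepts N w.
Proof.
have from_inter p q : @accepts_from _ (nfa_inter M N) (p, q) w <->
    accepts_from p w /\ accepts_from q w.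
  elim: w p q => [|a w IHw] p q /=; first by rewrite in_setX; split=> /andP.
  split=> [[[p' q']]|[[p' pp' p'w] [q' qq' q'w]]].
    by rewrite in_setX => /andP[pp' qq'] /IHw[p'w q'w]; split;
      [exists p' | exists q'].
  by exists (p', q'); [rewrite in_setX pp' | apply/IHw].
split=> [[[p q]]|[[p p0 pw] [q q0 qw]]].
  by rewrite in_setX => /andP[p0 q0] /from_inter[pw qw]; split;
    [exists p | exists q].
by exists (p, q); [rewrite in_setX p0 | apply/from_inter].
Qed.

Definition nfa_preim (f : A -> B) (N : nfa B) : nfa A :=
  @NFA A _ (nfa_nonempty N) (nfa_init N) (fun q a => nfa_trans q (f a))
    (nfa_final N).

Lemma accepts_preim (f : A -> B) (N : nfa B) w :
  accepts (nfa_preim f N) w <-> accepts N (map f w).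
Proof.
have from_preim q : @accepts_from _ (nfa_preim f N) q w <->
    @accepts_from _ N q (map f w).
  elim: w q => [|a w IHw] q //=.
  by split=> -[q' qq' /IHw q'w]; exists q'.
by split=> -[q q0 /from_preim qw]; exists q.
Qed.

Definition nfa_img (f : A -> B) (N : nfa A) : nfa B :=
  @NFA B _ (nfa_nonempty N) (nfa_init N)
    (fun q b => \bigcup_(a | f a == b) nfa_trans q a) (nfa_final N).

Lemma accepts_img (f : A -> B) (N : nfa A) w :
  accepts (nfa_img f N) w <-> exists2 v, map f v = w & accepts N v.
Proof.
have from_img q : @accepts_from _ (nfa_img f N) q w <->
    exists2 v, map f v = w & @accepts_from _ N q v.
  elim: w q => [|b w IHw] q /=.
    by split=> [qF|[[]]//]; exists [::].
  split=> [[q' /bigcupP[a /eqP<- qq'] /IHw[v <- q'v]]|].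
    by exists (a :: v) => //; exists q'.
  case=> -[|a v] //= [fa fv] [q' qq' q'v].
  by exists q'; [apply/bigcupP; exists a; rewrite ?fa | apply/IHw; exists v].
split=> [[q q0 /from_img[v fv qv]]|[v fv [q q0 qv]]].
  by exists v => //; exists q.
by exists q => //; apply/from_img; exists v.
Qed.

Lemma nfa_powerset_nonempty (N : nfa A) : 0 < #|{set nfa_state N}|.
Proof. by rewrite card_powersetT expn_gt0. Qed.

(** The subset automaton with inverted acceptance. The empty set is a state too, so words on which
    every run of [N] dies are accepted. *)
Definition nfa_compl (N : nfa A) : nfa A :=
  @NFA A _ (nfa_powerset_nonempty N) [set nfa_init N]
    (fun (X : {set nfa_state N}) a => [set \bigcup_(q in X) nfa_trans q a])
    [set X : {set nfa_state N} | [disjoint X & nfa_final N]].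

Lemma nfa_size_compl (N : nfa A) : nfa_size (nfa_compl N) = 2 ^ nfa_size N.
Proof. exact: card_powersetT. Qed.

Lemma accepts_compl (N : nfa A) w : accepts (nfa_compl N) w <-> ~ accepts N w.
Proof.
(* The induction needs an arbitrary set [X], since reading a letter replaces the initial set by its
   successor set. *)
have from_compl (X : {set nfa_state N}) : @accepts_from _ (nfa_compl N) X w <->
    ~ exists2 q, q \in X & @accepts_from _ N q w.
  elim: w X => [|a w IHw] X /=.
    rewrite inE disjoint_subset; split=> [/subsetP XF [q /XF /negP]//|XF].
    by apply/subsetP=> q qX; apply/negP=> qF; apply: XF; exists q.
  split=> [[X' /set1P-> /IHw X'w] [q qX [q' qq' q'w]]|Xw].
    by apply: X'w; exists q' => //; apply/bigcupP; exists q.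
  exists (\bigcup_(q in X) nfa_trans q a); first exact: set11.
  apply/IHw=> -[q' /bigcupP[q qX qq'] q'w].
  by apply: Xw; exists q => //; exists q'.
split=> [[X /set1P-> /from_compl]//|Nw].
by exists (nfa_init N); [exact: set11 | apply/from_compl].
Qed.

(** A complement without blow-up: the run on each word is unique when [N] is deterministic. *)
Definition dfa_compl (N : nfa A) : nfa A :=
  @NFA A _ (nfa_nonempty N) (nfa_init N) (@nfa_trans _ N) (~: nfa_final N).

Lemma accepts_dfa_compl (N : nfa A) w : deterministic N ->
  accepts (dfa_compl N) w <-> ~ accepts N w.
Proof.
case=> /eqP/cards1P[q0 init1] trans1.
have from_compl q : @accepts_from _ (dfa_compl N) q w <->
    ~ @accepts_from _ N q w.
  elim: w q => [|a w IHw] q /=; first by rewrite inE; split=> /negP.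
  have /eqP/cards1P[q' ->] := trans1 q a.
  split=> [[_ /set1P-> /IHw q'w] [_ /set1P->]//|q'w].
  by exists q'; [exact: set11 | apply/IHw=> ?; apply: q'w; exists q';
    first exact: set11].
rewrite /accepts /= init1; split=> [[_ /set1P-> /from_compl q0w] [_ /set1P->]//|].
move=> q0w; exists q0; first exact: set11.
by apply/from_compl=> ?; apply: q0w; exists q0; first exact: set11.
Qed.

End Closure.

(** Every run stays in the only state, so acceptance depends only on whether that state is final;
    determinism ensures that a run on [w2] exists. *)
Lemma accepts_single_state (A : finType) (M : nfa A) w1 w2 :
  deterministic M -> nfa_size M = 1 -> accepts M w1 -> accepts M w2.
Proof.
move=> [init1 trans1] /fintype1[q0 allq0] [q q0M qw1].
exists q => // {q0M init1}.
have qF : q \in nfa_final M.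
  elim: w1 q qw1 => //= a w1 IH q [q' _ /IH].
  by rewrite (allq0 q) (allq0 q').
elim: w2 {w1 qw1} => //= a w2 IH; exists q => //.
have /eqP/cards1P[q' ->] := trans1 q a.
by rewrite (allq0 q) (allq0 q') set11.
Qed.

(** Cancelling one factor [m] leaves [2 ^ k <= m ^ k.-1], which follows from [4 <= m] and
    [k <= 2 * k.-1]. *)
Lemma mul_exp2_le_exp m k : 3 < m -> 1 < k -> 2 ^ k * m <= m ^ k.
Proof.
move=> m4; case: k => // k k0; rewrite [m ^ _]expnSr leq_mul2r.
apply/orP; right; apply: (@leq_trans (4 ^ k)); last by rewrite leq_exp2r.
by rewrite -[4]/(2 ^ 2) -expnM leq_exp2l // mul2n -addnn -addn1 leq_add2l.
Qed.

(** * The automaton for [IndInv] and its size *)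

Section Construction.
Variables (Sigma : finType) (S : rts Sigma) (V : interpretation Sigma).

Let Gamma := int_alphabet V.
Let I := rts_init S.
Let T := rts_trans S.
Let N := interpreter V.
Let triple := ((Sigma * Sigma) * Gamma)%type.
Let uW (x : triple) := (x.1.1, x.2).
Let wW (x : triple) := (x.1.2, x.2).

(** Used twice: intersected with [T] it describes violating steps, with [nfa_ind] separating
    invariants. The interpreter is deterministic, so [dfa_compl] suffices and the size stays
    quadratic. *)
Definition separation : nfa triple :=
  nfa_inter (nfa_preim uW N) (nfa_preim wW (dfa_compl N)).

Definition nfa_ind : nfa Gamma :=
  nfa_compl (nfa_img snd (nfa_inter (nfa_preim fst T) separation)).

Definition nfa_potreach : nfa (Sigma * Sigma)%type :=
  nfa_compl (nfa_img fst (nfa_inter (nfa_preim snd nfa_ind) separation)).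

Definition nfa_indinv : nfa Sigma :=
  nfa_img snd (nfa_inter (nfa_preim fst I) nfa_potreach).

(** [models] includes equality of lengths, so its negation amounts to rejection by the interpreter
    only for words of equal length. *)
Lemma accepts_separation u w W : size u = size w -> size w = size W ->
  accepts separation (zip (zip u w) W) <-> models u W /\ ~ models w W.
Proof.
move=> suw swW; have suW := etrans suw swW.
have uWE : map uW (zip (zip u w) W) = zip u W.
  by elim: u w W suw swW {suW} => [|a u IH] [|b w] [|g W] //= [?] [?]; rewrite IH.
have wWE : map wW (zip (zip u w) W) = zip w W.
  by elim: u w W suw swW {suW uWE} => [|a u IH] [|b w] [|g W] //= [?] [?];
    rewrite IH.
rewrite accepts_inter !accepts_preim uWE wWE.
rewrite accepts_dfa_compl; last exact: interpreter_det.
rewrite /models /accepts_pair; tauto.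
Qed.

Lemma triple_zip (z : seq triple) :
  exists u w W, [/\ size u = size w, size w = size W & z = zip (zip u w) W].
Proof.
exists (unzip1 (unzip1 z)), (unzip2 (unzip1 z)), (unzip2 z).
by rewrite !size_map !zip_unzip.
Qed.

Lemma accepts_ind W : accepts nfa_ind W <-> Ind S W.
Proof.
rewrite accepts_compl accepts_img; split=> [noviol u w uw uW_|ind [z zW]].
  have [suw Tuw] := uw; have [suW _] := uW_.
  have swW : size w = size W by rewrite -suw.
  (* The complement only rules out counterexamples; excluded middle turns this into [models w W]. *)
  have [] := boolp.pselect (models w W) => // nwW; case: noviol.
  exists (zip (zip u w) W).
    by rewrite -/unzip2 unzip2_zip // size_zip suw minnn swW.
  rewrite accepts_inter accepts_preim -/unzip1 unzip1_zip; last first.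
    by rewrite size_zip suw minnn swW.
  by split=> //; apply/accepts_separation.
have [u [w [W' [suw swW zE]]]] := triple_zip z.
have szW : size (zip u w) = size W' by rewrite size_zip suw minnn.
move: zW; rewrite {z}zE -/unzip2 unzip2_zip ?szW // => W'E; subst W'.
rewrite accepts_inter accepts_preim -/unzip1 unzip1_zip ?szW //.
by case=> Tuw /(accepts_separation suw swW)[uW_]; apply; apply: ind uW_.
Qed.

Lemma accepts_potreach u w : size u = size w ->
  accepts nfa_potreach (zip u w) <-> potreach S V u w.
Proof.
move=> suw; rewrite accepts_compl accepts_img.
split=> [nosep|[_ pot] [z zuw]].
  split=> // W indW uW_; have [suW _] := uW_.
  have swW : size w = size W by rewrite -suw.
  have szW : size (zip u w) = size W by rewrite size_zip suw minnn.
  have [] := boolp.pselect (models w W) => // nwW; case: nosep.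
  exists (zip (zip u w) W); first by rewrite -/unzip1 unzip1_zip ?szW.
  rewrite accepts_inter accepts_preim -/unzip2 unzip2_zip ?szW //.
  by split; [apply/accepts_ind | apply/accepts_separation].
have [u' [w' [W [suw' swW zE]]]] := triple_zip z.
have szW : size (zip u' w') = size W by rewrite size_zip suw' minnn.
move: zuw; rewrite {z}zE -/unzip1 unzip1_zip ?szW // => zE.
(* [zip] is injective on pairs of words of equal length. *)
have uE : u' = u by rewrite -(unzip1_zip (eq_leq suw')) zE unzip1_zip ?suw.
have wE : w' = w.
  by rewrite -(unzip2_zip (eq_leq (esym suw'))) zE unzip2_zip ?suw.
subst u' w'.
rewrite accepts_inter accepts_preim -/unzip2 unzip2_zip ?szW //.
by case=> /accepts_ind indW /(accepts_separation suw swW)[uW_]; apply; apply: pot.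
Qed.

Lemma recognizes_indinv : recognizes nfa_indinv (IndInv S V).
Proof.
move=> w; rewrite accepts_img; split=> [[z]|[u Iu uw]].
  rewrite -{2}(zip_unzip z) => <-; rewrite accepts_inter accepts_preim.
  rewrite accepts_potreach ?size_map // => -[Iu uw].
  by exists (unzip1 z) => //; rewrite /initial /unzip1; rewrite zip_unzip in Iu.
have [suw _] := uw; exists (zip u w); first by rewrite -/unzip2 unzip2_zip ?suw.
rewrite accepts_inter accepts_preim -/unzip1 unzip1_zip ?suw //.
by split=> //; apply/accepts_potreach.
Qed.

(** Images, preimages and [dfa_compl] keep the state set; only products and the two subset
    constructions change the size. *)
Lemma nfa_size_indinv : nfa_size nfa_indinv =
  nfa_size I * 2 ^ (2 ^ (nfa_size T * nfa_size N ^ 2) * nfa_size N ^ 2).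
Proof.
rewrite -mulnn [LHS](nfa_size_inter (nfa_preim fst I) nfa_potreach).
rewrite nfa_size_compl; congr (_ * 2 ^ _).
rewrite [LHS](nfa_size_inter (nfa_preim snd nfa_ind) separation).
rewrite [nfa_size (nfa_preim _ _)]nfa_size_compl nfa_size_inter.
congr (2 ^ _ * _).
by rewrite [LHS](nfa_size_inter (nfa_preim fst T) separation) nfa_size_inter.
Qed.

(** Each transition of [I] is relabelled by every letter, so only the length of an initial
    configuration is remembered. *)
Definition nfa_same_size : nfa Sigma := nfa_img snd (nfa_preim fst I).

Lemma recognizes_same_size :
  nfa_size N = 1 -> recognizes nfa_same_size (IndInv S V).
Proof.
move=> N1 w; rewrite accepts_img; split=> [[z <-]|[u Iu [suw _]]].
  rewrite accepts_preim => Iz; exists (map fst z) => //.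
  split=> [|W _ [sW zW]]; rewrite ?size_map //.
  split; first by rewrite size_map -sW size_map.
  by apply: accepts_single_state zW => //; exact: interpreter_det.
exists (zip u w); first by rewrite -/unzip2 unzip2_zip ?suw.
by rewrite accepts_preim -/unzip1 unzip1_zip ?suw.
Qed.

Lemma indinv_nfa_exists : exists M : nfa Sigma,
  recognizes M (IndInv S V) /\
  nfa_size M <=
    nfa_size I * 2 ^ ((nfa_size N ^ 2) ^ (nfa_size T * nfa_size N ^ 2)).
Proof.
have N0 : 0 < nfa_size N := nfa_nonempty N.
have T0 : 0 < nfa_size T := nfa_nonempty T.
(* For a one-state interpreter the bound is [nfa_size I * 2], while [nfa_indinv] has
   [nfa_size I * 2 ^ (2 ^ nfa_size T)] states. *)
have [N1|N1] := eqVneq (nfa_size N) 1.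
  exists nfa_same_size; split; first exact: recognizes_same_size.
  by rewrite leq_pmulr ?expn_gt0.
have N2 : 2 ^ 2 <= nfa_size N ^ 2.
  by rewrite leq_exp2r // ltn_neqAle eq_sym N1.
exists nfa_indinv; split; first exact: recognizes_indinv.
rewrite nfa_size_indinv leq_mul2l leq_exp2l // mul_exp2_le_exp ?orbT //.
(* The exponent [nfa_size T * nfa_size N ^ 2] exceeds 1, as it is at least [nfa_size N ^ 2], hence
   at least 4. *)
by apply: leq_trans (leq_pmull _ T0); apply: leq_trans N2.
Qed.

End Construction.

(** * Transfer of the bound from natural to real exponents *)

Import Order.TTheory GRing.Theory Num.Theory.
Local Open Scope ring_scope.

Lemma powR_log2 (R : realType) (x y : R) : 0 < x -> 2 `^ (log2 x * y) = x `^ y.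
Proof.
move=> x0; have ln2 : ln 2 != 0 :> R by rewrite gt_eqF // ln_gt0 ?ltr1n.
rewrite powRrM; congr (_ `^ _).
(* [powR] treats base 0 separately; base 2 selects the exponential branch, where the two factors
   [ln 2] cancel. *)
by rewrite /powR pnatr_eq0 /= divfK // lnK // posrE.
Qed.

Theorem theorem4p10 (R : realType) (Sigma : finType) (S : rts Sigma)
    (V : interpretation Sigma) :
  let nI : R := (nfa_size (rts_init S))%:R in
  let nT : R := (nfa_size (rts_trans S))%:R in
  let nV : R := (nfa_size (interpreter V))%:R in
  exists N : nfa Sigma,
    recognizes N (IndInv S V) /\
    (nfa_size N)%:R <= nI * 2 `^ (2 `^ (log2 (nV ^+ 2) * nT * nV ^+ 2)).
Proof.
move=> nI nT nV; have [M [MP Mle]] := indinv_nfa_exists S V.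
have nV0 : 0 < nV by rewrite ltr0n nfa_nonempty.
(* Regrouping the exponent as [log2 (nV ^+ 2) * (nT * nV ^+ 2)] lets the logarithm vanish; all
   remaining exponents are natural numbers, so the inequality descends to [nat]. *)
exists M; split=> //; rewrite -mulrA powR_log2 ?exprn_gt0 //.
rewrite /nT /nV -!natrX -!natrM powR_mulrn // -natrX powR_mulrn //.
by rewrite -natrX -natrM ler_nat.
Qed.
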